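(* Let $G=(V,E,m,\mu)$ be a complete weighted graph whose measure $m$ is non-degenerate, i.e. $\inf_{x\in V}m(x)>0$, and let $K\in\mathbb{R}$. Then the following are equivalent: (a) $G$ satisfies the curvature dimension condition $\mathrm{CD}(K,\infty)$. (b) For every $f\in C_0(V)$ and every $t\ge 0$, the pointwise inequality $$\Gamma(P_t f)\leq e^{-2Kt}P_t(\Gamma (f))$$ holds on $V$.
   Context: Weighted graphs: $(V,E)$ is a (finite or infinite) undirected, connected, locally finite graph (every vertex has finitely many neighbors; self-loops are allowed); $x\sim y$ means $(x,y)\in E$. $\mu:E\to(0,\infty)$, $(x,y)\mapsto\mu_{xy}$, is symmetric and extended by $\mu_{xy}=0$ if $x\not\sim y$; $m:V\to(0,\infty)$ is a measure on $V$. The quadruple $G=(V,E,m,\mu)$ is called a weighted graph. $C_0(V)$ is the set of finitely supported functions $V\to\mathbb{R}$; $\ell^p_m=\ell^p(V,m)$. Formal Laplacian, for all $f:V\to\mathbb{R}$: $\Delta f(x)=\frac{1}{m(x)}\sum_{y}\mu_{xy}(f(y)-f(x))$. $\Gamma$-calculus: $\Gamma(f,g)(x)=\frac12(\Delta(fg)-f\Delta g-g\Delta f)(x)=\frac{1}{2m(x)}\sum_y\mu_{xy}(f(y)-f(x))(g(y)-g(x))$, $\Gamma(f)=\Gamma(f,f)$; $\Gamma_2(f)=\frac12\Delta\Gamma(f)-\Gamma(f,\Delta f)$. $\mathrm{CD}(K,\infty)$: $\Gamma_2(f)(x)\ge K\Gamma(f)(x)$ for all $f:V\to\mathbb{R}$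 and all $x\in V$. Complete graph: there is a nondecreasing sequence $\{\eta_k\}_{k=1}^\infty\subset C_0(V)$ with $\lim_{k\to\infty}\eta_k=\mathds{1}$ pointwise ($\mathds{1}$ the constant function $1$) and $\Gamma(\eta_k)\le\frac1k$ on $V$ for every $k$. Heat semigroup: $Q^{(D)}(f,g)=\frac12\sum_{x,y\in V}\mu_{xy}(f(y)-f(x))(g(y)-g(x))$ with domain $D(Q^{(D)})$ the completion of $C_0(V)$ under $\|f\|_Q=\left(\|f\|_{\ell^2_m}^2+\frac12\sum_{x,y}\mu_{xy}(f(y)-f(x))^2\right)^{1/2}$ is a Dirichlet form on $\ell^2_m$. Its generator is the self-adjoint operator $L$ on $\ell^2_m$ with $-L\ge0$ and $Q^{(D)}(f,g)=\langle(-L)^{1/2}f,(-L)^{1/2}g\rangle$; $L$ acts as $\Delta$ on its domain. $P_t=e^{tL}$ is the associated semigroup on $\ell^2_m$, which extends to $\ell^p_m$ for all $p\in[1,\infty]$ (explicitly, $P_tf(x)=\sum_y p_t(x,y)f(y)m(y)$ with heat kernel $p_t(x,y)=m(y)^{-1}(P_t\delta_y)(x)$, where $\delta_y$ is the indicator function of $\{y\}$). *)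

(* Defs.v *)
From HB Require Import structures.
From mathcomp Require Export all_boot all_order all_algebra.
From mathcomp Require Export all_classical all_reals all_analysis.
Import Order.TTheory GRing.Theory Num.Theory.
Import numFieldNormedType.Exports.

Set Implicit Arguments.
Unset Strict Implicit.
Unset Printing Implicit Defensive.

Local Open Scope classical_set_scope.
Local Open Scope ring_scope.

(* Loops are allowed: [edge] need not be irreflexive. *)
Record weighted_graph (R : realType) (V : choiceType) := WeightedGraph {
  edge : rel V;
  edge_sym : symmetric edge;
  edge_connected :
    forall x y, exists2 p : seq V, path edge x p & last x p = y;
  edge_locally_finite : forall x, finite_set [set y | edge x y];
  mu : V -> V -> R;
  mu_sym : forall x y, mu x y = mu y x;
  mu_gt0 : forall x y, edge x y -> 0 < mu x y;
  mu_eq0 : forall x y, ~~ edge x y -> mu x y = 0;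
  m : V -> R;
  m_gt0 : forall x, 0 < m x }.

Section Calculus.
Context {R : realType} {V : choiceType} (G : weighted_graph R V).
Implicit Types (f g h : V -> R) (x y : V).

Definition C0 : set (V -> R) := [set f | finite_set [set x | f x != 0]].

Definition Delta f : V -> R := fun x =>
  (m G x)^-1 * \sum_(y \in [set y | edge G x y]) mu G x y * (f y - f x).

Definition Gamma f g : V -> R := fun x =>
  2^-1 * (Delta (f \* g) x - f x * Delta g x - g x * Delta f x).

Definition Gamma2 f : V -> R := fun x =>
  2^-1 * Delta (Gamma f f) x - Gamma f (Delta f) x.

Definition CD_infty (K : R) :=
  forall f x, K * Gamma f f x <= Gamma2 f x.

(* [eta k] is the (k+1)-st function of the exhausting sequence, which is
   indexed from 1 on paper. *)
Definition complete_graph :=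
  exists eta : nat -> V -> R,
    [/\ forall k, C0 (eta k),
        forall k x, eta k x <= eta k.+1 x,
        forall x, eta k x @[k --> \oo] --> (1 : R)
      & forall k x, Gamma (eta k) (eta k) x <= k.+1%:R^-1].

Definition nondegenerate_measure :=
  (0 < ereal_inf (range (fun x => (m G x)%:E)))%E.

(* Unordered sum of an absolutely summable family (the value is meaningless
   otherwise); \esum alone only handles nonnegative families. *)
Definition rsum (T : choiceType) (u : T -> R) : R :=
  fine (esum setT (EFin \o u)^\+ - esum setT (EFin \o u)^\-)%E.

Definition l2sq f : \bar R := \esum_(x in setT) (m G x * f x ^+ 2)%:E.

Definition l2 : set (V -> R) := [set f | (l2sq f < +oo)%E].

Definition l2norm f : R := Num.sqrt (fine (l2sq f)).

Definition l2dot f g : R := rsum (fun x => m G x * (f x * g x)).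

Definition energy f g : R :=
  2^-1 * rsum (fun p : V * V =>
    mu G p.1 p.2 * ((f p.2 - f p.1) * (g p.2 - g p.1))).

Definition Qnormsq f : \bar R :=
  (l2sq f + (2^-1)%:E *
    \esum_(p in [set: V * V]) (mu G p.1 p.2 * (f p.2 - f p.1) ^+ 2)%:E)%E.

(* The completion of C0 for the form norm, realised inside l2: limits of
   C0 functions for that norm. Membership forces [Qnormsq f < +oo]. *)
Definition domQ : set (V -> R) :=
  [set f | forall e : R, 0 < e ->
     exists2 g, C0 g & (Qnormsq (f - g)%R < e%:E)%E].

(* Since m > 0 everywhere, an element of l2 is an actual function, so operators
   may be compared with Leibniz equality. Off [dom], [act] is arbitrary. *)
Record operator := Operator {
  dom : set (V -> R);
  act : (V -> R) -> V -> R }.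

Implicit Types A L S : operator.

Definition linear_operator A :=
  [/\ dom A `<=` l2,
      forall f, dom A f -> l2 (act A f),
      dom A 0
    & forall (a : R) f g, dom A f -> dom A g ->
        dom A (a *: f + g) /\ act A (a *: f + g) = a *: act A f + act A g].

Definition densely_defined A :=
  forall f, l2 f -> forall e : R, 0 < e ->
    exists2 g, dom A g & l2norm (f - g) < e.

(* The second conjunct of the equivalence says that (g, h) is in the graph of
   the adjoint of A. *)
Definition self_adjoint A :=
  [/\ linear_operator A, densely_defined A
    & forall g h, (dom A g /\ act A g = h) <->
        [/\ l2 g, l2 h & forall f, dom A f -> l2dot (act A f) g = l2dot f h]].

Definition nonneg_operator A := forall f, dom A f -> 0 <= l2dot (act A f) f.

Definition opp_operator A := Operator (dom A) (fun f => - act A f).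

(* S = A^(1/2) for a nonnegative self-adjoint operator A. *)
Definition is_sqrt_operator S A :=
  [/\ self_adjoint S, nonneg_operator S,
      forall f, dom A f <-> dom S f /\ dom S (act S f)
    & forall f, dom A f -> act S (act S f) = act A f].

Definition is_form_generator L :=
  [/\ self_adjoint L, nonneg_operator (opp_operator L)
    & exists S, [/\ is_sqrt_operator S (opp_operator L), dom S = domQ
        & forall f g, domQ f -> domQ g ->
            energy f g = l2dot (act S f) (act S g)]].

(* P t = e^(tL) on l2: the strongly continuous semigroup of bounded operators
   whose infinitesimal generator, domain included, is L. *)
Definition is_semigroup_generated_by L (P : R -> (V -> R) -> V -> R) :=
  [/\ forall t : R, 0 <= t ->
        [/\ forall f, l2 f -> l2 (P t f),
            forall (a : R) f g, l2 f -> l2 g ->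
              P t (a *: f + g) = a *: P t f + P t g
          & exists C : R, forall f, l2 f -> l2norm (P t f) <= C * l2norm f],
      forall f, l2 f -> P 0 f = f,
      forall (s t : R) f, 0 <= s -> 0 <= t -> l2 f -> P (s + t) f = P s (P t f),
      forall f, l2 f -> forall t0 : R, 0 <= t0 ->
        l2norm (P t f - P t0 f)
          @[t --> within [set t | 0 <= t] (nbhs t0)] --> (0 : R)
    & forall f h, (dom L f /\ act L f = h) <->
        [/\ l2 f, l2 h
          & l2norm (t^-1 *: (P t f - f) - h) @[t --> 0^'+] --> (0 : R)]].

(* This determines P t on l2, for t >= 0, and nothing else about P. *)
Definition is_heat_semigroup (P : R -> (V -> R) -> V -> R) :=
  exists2 L, is_form_generator L & is_semigroup_generated_by L P.

End Calculus.

(* Main.v *)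
(* For f finitely supported put u_t = P_t f and
   v_t = Gamma(u_t) - e^(-2Kt) P_t Gamma(f).
   CD(K, oo) makes v a pointwise subsolution,
   dv_t/dt <= Delta v_t - 2K v_t, with v_0 = 0. Completeness and a
   Caccioppoli estimate bound sum m Gamma(u_t) by the l2 norms of u_t and
   Delta u_t = P_t (Delta f); since m is bounded below, l1 embeds into l2, hence
   v_t is bounded in l2, locally uniformly in t. For the positive part v_t^+ the
   finite sum phi_k(t) = sum_x m eta_k^2 (v_t^+)^2 then satisfies
   phi_k' <= C phi_k + O(1/k), the error coming from Gamma(eta_k) <= 1/k, so
   Gronwall and k -> oo give v_t <= 0. Conversely, v_t <= 0 = v_0 forces the right
   derivative of v at t = 0 to be nonpositive, which is the curvature
   inequality for f; the general case follows because Gamma_2 is local. *)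
Require Import Defs.
From mathcomp Require Import ring lra.
Import Order.TTheory GRing.Theory Num.Theory.
Import numFieldNormedType.Exports.
Local Open Scope classical_set_scope.
Local Open Scope ring_scope.

Set Implicit Arguments.
Unset Strict Implicit.
Unset Printing Implicit Defensive.

(** * Finite sums and summation by parts *)

Section FiniteSums.
Context {R : realType}.

Lemma eq_big_support (T : eqType) (s s' : seq T) (F : T -> R) :
  uniq s -> uniq s' -> (forall x, F x != 0 -> (x \in s) = (x \in s')) ->
  \sum_(x <- s) F x = \sum_(x <- s') F x.
Proof.
move=> us us' ss'.
rewrite (bigID (fun x => F x != 0)) /= [X in _ + X]big1 ?addr0; last first.
  by move=> x; rewrite negbK => /eqP.
rewrite [RHS](bigID (fun x => F x != 0)) /= [X in _ = _ + X]big1 ?addr0; last first.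
  by move=> x; rewrite negbK => /eqP.
rewrite -big_filter -[RHS]big_filter; apply: perm_big.
apply: uniq_perm; rewrite ?filter_uniq// => x.
by rewrite !mem_filter; case: (boolP (F x != 0)) => //= /ss'.
Qed.

(** Every infinite sum met below has a finitely supported factor, so this turns [l2dot] and [energy]
    into finite sums. The positive and negative parts of [u] vanish wherever [u] does, so each
    [esum] reduces to the same list. *)
Lemma rsum_seq (T : choiceType) (s : seq T) (u : T -> R) :
  uniq s -> (forall x, u x != 0 -> x \in s) ->
  rsum u = \sum_(x <- s) u x.
Proof.
move=> us hu.
have esum_seq (w : T -> R) : (forall x, 0 <= w x) ->
    (forall x, w x != 0 -> x \in s) ->
    \esum_(x in setT) (w x)%:E = (\sum_(x <- s) w x)%:E.
  move=> w0 hw; rewrite -sumEFin fsbig_seq//.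
  rewrite -(@esum_fset R T [set` s] (EFin \o w)) /=; last 2 first.
  - by apply/finite_seqP; exists s.
  - by move=> i _; rewrite lee_fin.
  rewrite [RHS]esum_mkcond; apply: eq_esum => x _.
  case: ifPn => //; rewrite notin_setE /= => xs.
  have [->//|/hw] := eqVneq (w x) 0.
  by move=> h; case: xs.
pose up x := Num.max (u x) 0.
pose un x := Num.max (- u x) 0.
rewrite /rsum.
have -> : ((EFin \o u)^\+)%E = (fun x => (up x)%:E).
  by apply/funext => x; rewrite funeposE /up /= EFin_max.
have -> : ((EFin \o u)^\-)%E = (fun x => (un x)%:E).
  by apply/funext => x; rewrite funenegE /un /= EFin_max.
have xs (w : T -> R) x : (forall x, u x = 0 -> w x = 0) -> w x != 0 -> x \in s.
  move=> h wx; apply: hu; apply: contra_neq wx; exact: h.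
rewrite !esum_seq; last 4 first.
- by move=> x; rewrite le_max lexx orbT.
- by move=> x; apply: (xs un) => y; rewrite /un => ->; rewrite oppr0 maxxx.
- by move=> x; rewrite le_max lexx orbT.
- by move=> x; apply: (xs up) => y; rewrite /up => ->; rewrite maxxx.
rewrite -EFinB /= -sumrB; apply: eq_bigr => x _.
by rewrite /up /un /Num.max; case: ltP => h1; case: ltP => h2; lra.
Qed.

(** Exchanging [x] and [y] in the left side and using the symmetry of [a] replaces [g x] by [- g y];
    adding the two expressions yields the product of differences. *)
Lemma green_seq (T : eqType) (s : seq T) (a : T -> T -> R) (f g : T -> R) :
  (forall x y, a x y = a y x) ->
  \sum_(x <- s) g x * (\sum_(y <- s) a x y * (f y - f x)) =
  - (2^-1 * \sum_(x <- s) \sum_(y <- s) a x y * ((f y - f x) * (g y - g x))).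
Proof.
move=> asym.
set S := LHS.
have S1 : S = \sum_(x <- s) \sum_(y <- s) a x y * ((f y - f x) * g x).
  by apply: eq_bigr => x _; rewrite mulr_sumr; apply: eq_bigr => y _; ring.
have S2 : S = - \sum_(x <- s) \sum_(y <- s) a x y * ((f y - f x) * g y).
  rewrite S1 exchange_big /= -sumrN; apply: eq_bigr => x _.
  by rewrite -sumrN; apply: eq_bigr => y _; rewrite asym; ring.
have -> : \sum_(x <- s) \sum_(y <- s) a x y * ((f y - f x) * (g y - g x)) = - S - S.
  rewrite {1}S2 opprK {1}S1 -sumrB; apply: eq_bigr => x _.
  by rewrite -sumrB; apply: eq_bigr => y _; ring.
by lra.
Qed.

End FiniteSums.

(** * Laplacian and carré du champ computed on finite lists of vertices *)

Section GraphCalculus.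
Context {R : realType} {V : choiceType} (G : weighted_graph R V).
Implicit Types (f g h : V -> R) (x y : V) (s : seq V).

Definition nbr x : seq V := finmap.enum_fset (fset_set [set y | edge G x y]).

Lemma mem_nbr x y : (y \in nbr x) = edge G x y.
Proof.
rewrite /nbr in_fset_set; last exact: edge_locally_finite.
by apply/idP/idP; rewrite inE.
Qed.

Lemma nbr_uniq x : uniq (nbr x). Proof. exact: finmap.fset_uniq. Qed.

Lemma DeltaE f x :
  Delta G f x = (m G x)^-1 * \sum_(y <- nbr x) mu G x y * (f y - f x).
Proof. by rewrite /Delta fsbig_finite//; exact: edge_locally_finite. Qed.

Lemma m_neq0 x : m G x != 0. Proof. by rewrite gt_eqF// m_gt0. Qed.

Lemma mu_ge0 x y : 0 <= mu G x y.
Proof.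
have [/mu_gt0/ltW//|/mu_eq0->//] := boolP (edge G x y).
Qed.

Lemma GammaE f g x : Gamma G f g x =
  (2 * m G x)^-1 * \sum_(y <- nbr x) mu G x y * ((f y - f x) * (g y - g x)).
Proof.
rewrite /Gamma !DeltaE /=.
have -> : \sum_(y <- nbr x) mu G x y * ((f y - f x) * (g y - g x)) =
   \sum_(y <- nbr x) mu G x y * (f y * g y - f x * g x)
   - f x * (\sum_(y <- nbr x) mu G x y * (g y - g x))
   - g x * (\sum_(y <- nbr x) mu G x y * (f y - f x)).
  by rewrite !mulr_sumr -!sumrB; apply: eq_bigr => y _; ring.
rewrite invfM; ring.
Qed.

Lemma Gamma_ge0 f x : 0 <= Gamma G f f x.
Proof.
rewrite GammaE mulr_ge0 ?invr_ge0 ?mulr_ge0 ?(ltW (m_gt0 G x))//.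
by apply: sumr_ge0 => y _; rewrite mulr_ge0 ?mu_ge0// -expr2 sqr_ge0.
Qed.

Lemma Delta_seq s f x : uniq s ->
  (forall y, edge G x y -> f y != f x -> y \in s) ->
  m G x * Delta G f x = \sum_(y <- s) mu G x y * (f y - f x).
Proof.
move=> us hs; rewrite DeltaE mulVKf ?m_neq0//.
apply: eq_big_support => //; first exact: nbr_uniq.
move=> y; rewrite mem_nbr mulf_eq0 negb_or subr_eq0 => /andP[muxy fxy].
have exy : edge G x y by apply: contra_neqT muxy => /mu_eq0.
by rewrite exy hs.
Qed.

Lemma Gamma_seq s f g x : uniq s -> {subset nbr x <= s} ->
  2 * m G x * Gamma G f g x =
  \sum_(y <- s) mu G x y * ((f y - f x) * (g y - g x)).
Proof.
move=> us hs; rewrite GammaE mulVKf ?mulf_neq0 ?m_neq0 ?pnatr_eq0//.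
apply: eq_big_support => //; first exact: nbr_uniq.
move=> y; rewrite mem_nbr mulf_eq0 negb_or => /andP[muxy _].
have exy : edge G x y by apply: contra_neqT muxy => /mu_eq0.
by rewrite exy hs// mem_nbr.
Qed.

(** All terms are nonnegative, so losing the neighbours of [x] outside [s] only decreases the
    sum. *)
Lemma sum_le_Gamma s f x : uniq s ->
  \sum_(y <- s) mu G x y * (f y - f x) ^+ 2 <= 2 * m G x * Gamma G f f x.
Proof.
move=> us.
rewrite (@Gamma_seq (undup (s ++ nbr x))) ?undup_uniq//; last first.
  by move=> y yx; rewrite mem_undup mem_cat yx orbT.
under [leRHS]eq_bigr do rewrite -expr2.
rewrite [leRHS](bigID (mem s)) /= -[X in _ <= X + _]big_filter.
rewrite [X in _ <= X + _](@eq_big_support _ _ _ s)//; last 2 first.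
- by rewrite filter_uniq// undup_uniq.
- by move=> y _; rewrite mem_filter mem_undup mem_cat; case: (y \in s).
by rewrite lerDl sumr_ge0// => y _; rewrite mulr_ge0 ?mu_ge0 ?sqr_ge0.
Qed.

(** The closed one-step neighbourhood of [s]; iterating it gives larger balls. *)
Definition hull s : seq V := undup (s ++ flatten [seq nbr x | x <- s]).

Lemma hull_uniq s : uniq (hull s). Proof. exact: undup_uniq. Qed.

Lemma sub_hull s : {subset s <= hull s}.
Proof. by move=> x xs; rewrite /hull mem_undup mem_cat xs. Qed.

Lemma nbr_hull s x : x \in s -> {subset nbr x <= hull s}.
Proof.
move=> xs y yx; rewrite /hull mem_undup mem_cat; apply/orP; right.
by apply/flattenP; exists (nbr x) => //; apply: map_f.
Qed.

Lemma C0P f : C0 f -> {s : seq V | uniq s & forall x, f x != 0 -> x \in s}.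
Proof.
move=> f0; exists (finmap.enum_fset (fset_set [set x | f x != 0])); first exact: finmap.fset_uniq.
by move=> x fx; rewrite in_fset_set// inE.
Qed.

Lemma C0_seq s f : (forall x, f x != 0 -> x \in s) -> C0 f.
Proof.
move=> h; apply: (@sub_finite_set _ _ [set` s]); first exact: h.
by apply/finite_seqP; exists s.
Qed.

(** The form in which finite support is used: every edge touching the support stays inside the list,
    so summation by parts on it has no boundary term. *)
Lemma C0_surround f : C0 f ->
  {s : seq V | uniq s & forall x, f x != 0 -> x \in s /\ {subset nbr x <= s}}.
Proof.
move=> /C0P[s us hs]; exists (hull s); first exact: hull_uniq.
by move=> x /hs xs; split; [exact: sub_hull|exact: nbr_hull].
Qed.

Lemma Delta_support s g :
  (forall x, g x != 0 -> x \in s /\ {subset nbr x <= s}) ->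
  forall x, Delta G g x != 0 -> x \in s.
Proof.
move=> hs x; apply: contra_neqT => xs; rewrite DeltaE big_seq big1 ?mulr0// => y.
rewrite mem_nbr => exy.
have -> : g x = 0 by apply: contraNeq xs => /hs[].
suff -> : g y = 0 by rewrite subrr mulr0.
apply: contraNeq xs => /hs[_]; apply.
by rewrite mem_nbr edge_sym.
Qed.

Lemma C0_Delta f : C0 f -> C0 (Delta G f).
Proof. by move=> /C0_surround[s _ /Delta_support]; exact: C0_seq. Qed.

Lemma C0_lin (a b : R) f g : C0 f -> C0 g -> C0 (fun x => a * f x + b * g x).
Proof.
move=> /C0P[s _ hs] /C0P[s' _ hs']; apply: (@C0_seq (s ++ s')) => x.
rewrite mem_cat; apply: contra_neqT; rewrite negb_or => /andP[xs xs'].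
have -> : f x = 0 by apply: contraNeq xs => /hs.
have -> : g x = 0 by apply: contraNeq xs' => /hs'.
by rewrite !mulr0 addr0.
Qed.

Lemma C0_mull f g : C0 f -> C0 (f \* g).
Proof.
move=> /C0P[s _ hs]; apply: (@C0_seq s) => x /=.
by rewrite mulf_eq0 negb_or => /andP[/hs].
Qed.

Lemma C0_Gamma f : C0 f -> C0 (Gamma G f f).
Proof.
move=> f0.
have h1 := C0_lin 2^-1 (- 1) (C0_Delta (C0_mull f f0)) (C0_mull (Delta G f) f0).
apply: sub_finite_set h1 => x /=; apply: contra_neq.
by rewrite /Gamma /= => h; rewrite -[RHS]h; field.
Qed.

Lemma green s f g : uniq s ->
  (forall x, g x != 0 -> x \in s /\ {subset nbr x <= s}) ->
  \sum_(x <- s) g x * (m G x * Delta G f x) =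
  - (2^-1 * \sum_(x <- s) \sum_(y <- s)
       mu G x y * ((f y - f x) * (g y - g x))).
Proof.
move=> us hs; rewrite -green_seq; last exact: mu_sym.
apply: eq_big_seq => x _.
have [->|/hs[xs nxs]] := eqVneq (g x) 0; first by rewrite !mul0r.
congr (_ * _); apply: Delta_seq => // y exy _.
by apply: nxs; rewrite mem_nbr.
Qed.

(** Only [g] is finitely supported. An edge from [s] to its complement has [g] equal to 0 at both
    ends, so it contributes nothing to [Delta G g]. *)
Lemma Delta_sym s f g : uniq s ->
  (forall x, g x != 0 -> x \in s /\ {subset nbr x <= s}) ->
  \sum_(x <- s) g x * (m G x * Delta G f x) =
  \sum_(x <- s) f x * (m G x * Delta G g x).
Proof.
move=> us hs; rewrite green//.
transitivity (\sum_(x <- s) f x * (\sum_(y <- s) mu G x y * (g y - g x))).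
  rewrite green_seq; last exact: mu_sym.
  congr (- (_ * _)); apply: eq_bigr => x _; apply: eq_bigr => y _; ring.
apply: eq_big_seq => x xs; congr (_ * _); apply/esym/Delta_seq => // y exy gyx.
have [gy0|/hs[]//] := eqVneq (g y) 0.
have /hs[_ +] : g x != 0 by apply: contra_neq gyx => ->.
by apply; rewrite mem_nbr.
Qed.

End GraphCalculus.

(** * The weighted space of square-summable functions *)

Section SquareSummable.
Context {R : realType} {V : choiceType} (G : weighted_graph R V).
Implicit Types (f g h : V -> R) (x y : V) (s : seq V).

Lemma l2sq_seq s f : uniq s ->
  ((\sum_(x <- s) m G x * f x ^+ 2)%:E <= l2sq G f)%E.
Proof.
move=> us; apply: esum_ge; exists [set` s].
  by split=> //; apply/finite_seqP; exists s.
by rewrite -fsbig_seq// sumEFin.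
Qed.

Lemma l2sq_le (c : R) f :
  (forall s, uniq s -> \sum_(x <- s) m G x * f x ^+ 2 <= c) ->
  (l2sq G f <= c%:E)%E.
Proof.
move=> h; apply: ge_ereal_sup => _ [A [finA _] <-].
rewrite fsbig_finite// sumEFin lee_fin; apply: h; exact: finmap.fset_uniq.
Qed.

Lemma l2sq_ge0 f : (0 <= l2sq G f)%E.
Proof.
by apply: esum_ge0 => x _; rewrite lee_fin mulr_ge0 ?sqr_ge0// ltW// m_gt0.
Qed.

Lemma l2normE f : l2 G f -> l2sq G f = (l2norm G f ^+ 2)%:E.
Proof.
move=> lf; rewrite /l2norm sqr_sqrtr ?fine_ge0 ?l2sq_ge0// fineK//.
by rewrite ge0_fin_numE ?l2sq_ge0.
Qed.

Lemma l2_seq s f : l2 G f -> uniq s ->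
  \sum_(x <- s) m G x * f x ^+ 2 <= l2norm G f ^+ 2.
Proof. by move=> lf us; rewrite -lee_fin -l2normE// l2sq_seq. Qed.

Lemma l2_bound (c : R) f :
  (forall s, uniq s -> \sum_(x <- s) m G x * f x ^+ 2 <= c) -> l2 G f.
Proof. by move=> h; apply: le_lt_trans (l2sq_le h) _; rewrite ltry. Qed.

Lemma l2norm_le (c : R) f :
  (forall s, uniq s -> \sum_(x <- s) m G x * f x ^+ 2 <= c) ->
  l2norm G f ^+ 2 <= c.
Proof.
by move=> h; rewrite -lee_fin -l2normE; [exact: l2sq_le|exact: l2_bound h].
Qed.

Lemma sum_sqr_lin_le s (a : R) f g :
  \sum_(x <- s) m G x * (a * f x + g x) ^+ 2 <=
  2 * a ^+ 2 * \sum_(x <- s) m G x * f x ^+ 2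
  + 2 * \sum_(x <- s) m G x * g x ^+ 2.
Proof.
rewrite !mulr_sumr -big_split; apply: ler_sum => x _ /=.
have -> : 2 * a ^+ 2 * (m G x * f x ^+ 2) + 2 * (m G x * g x ^+ 2) =
  m G x * (2 * a ^+ 2 * f x ^+ 2 + 2 * g x ^+ 2) by ring.
rewrite ler_wpM2l ?(ltW (m_gt0 G x))// -subr_ge0.
have -> : 2 * a ^+ 2 * f x ^+ 2 + 2 * g x ^+ 2 - (a * f x + g x) ^+ 2 =
  (a * f x - g x) ^+ 2 by ring.
exact: sqr_ge0.
Qed.

Lemma l2_lin (a : R) f g : l2 G f -> l2 G g -> l2 G (a *: f + g).
Proof.
move=> lf lg.
apply: (@l2_bound (2 * a ^+ 2 * l2norm G f ^+ 2 + 2 * l2norm G g ^+ 2)).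
move=> s us; apply: le_trans (sum_sqr_lin_le _ _ _ _) _.
by rewrite lerD// ler_wpM2l ?l2_seq// mulr_ge0// sqr_ge0.
Qed.

Lemma l2B f g : l2 G f -> l2 G g -> l2 G (f - g).
Proof. by move=> lf lg; rewrite addrC -scaleN1r; apply: l2_lin. Qed.

Lemma l2Z (a : R) f : l2 G f -> l2 G (a *: f).
Proof.
move=> lf; rewrite -[_ *: _]addr0 -(subrr f).
by apply: l2_lin => //; exact: l2B.
Qed.

Lemma l2norm_sqrD f g : l2 G f -> l2 G g ->
  l2norm G f ^+ 2 <= 2 * l2norm G (f - g) ^+ 2 + 2 * l2norm G g ^+ 2.
Proof.
move=> lf lg; apply: l2norm_le => s us.
have := sum_sqr_lin_le s 1 (f - g) g; rewrite expr1n mulr1.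
under eq_bigr do rewrite mul1r addrNK.
move/le_trans; apply.
by rewrite lerD// ler_wpM2l// l2_seq//; apply: l2B.
Qed.

Lemma C0_l2 f : C0 f -> l2 G f.
Proof.
move=> /C0P[s us hs]; apply: (@l2_bound (\sum_(x <- s) m G x * f x ^+ 2)).
move=> s' us'; rewrite (bigID (mem s)) /= [X in _ + X]big1 ?addr0; last first.
  move=> x xs; have -> : f x = 0 by apply: contraNeq xs => /hs.
  by rewrite expr0n mulr0.
rewrite -big_filter [leRHS](bigID (mem s')) /=.
rewrite -[X in _ <= X + _]big_filter.
rewrite (@eq_big_support _ _ [seq x <- s' | x \in s] [seq x <- s | x \in s'])
  ?filter_uniq//; last first.
  by move=> x _; rewrite !mem_filter andbC.
by rewrite lerDl sumr_ge0// => x _; rewrite mulr_ge0 ?sqr_ge0// ltW// m_gt0.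
Qed.

(** A single vertex contributes [m G x * f x ^+ 2] to the squared norm, and [m G x] is positive. *)
Lemma l2_pointwise f x : l2 G f ->
  `|f x| <= (Num.sqrt (m G x))^-1 * l2norm G f.
Proof.
move=> lf; have smx : 0 < Num.sqrt (m G x) by rewrite sqrtr_gt0 m_gt0.
rewrite mulrC ler_pdivlMr// -(@ler_pXn2r _ 2%N) ?nnegrE ?mulr_ge0 ?normr_ge0 ?sqrtr_ge0//.
rewrite exprMn sqr_sqrtr ?(ltW (m_gt0 G x))// real_normK ?num_real// mulrC.
by have := @l2_seq [:: x] f lf isT; rewrite big_seq1.
Qed.

(** The semigroup is continuous and differentiable in norm, whereas the curvature inequality is
    pointwise. Membership in [l2] has to be assumed near the limit because [l2norm] takes the
    default value 0 on functions of infinite norm. *)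
Lemma l2_cvg_pointwise (T : Type) (F : set_system T) {FF : Filter F}
    (u : T -> V -> R) f :
  (\forall h \near F, l2 G (u h - f)) ->
  l2norm G (u h - f) @[h --> F] --> (0 : R) ->
  forall x, u h x @[h --> F] --> f x.
Proof.
move=> lu cu x; apply/subr_cvg0.
suff: `|u h x - f x| @[h --> F] --> (0 : R) by move/norm_cvg0P.
have c0 : (Num.sqrt (m G x))^-1 * l2norm G (u h - f) @[h --> F] --> (0 : R).
  by rewrite -[X in _ --> X](mulr0 (Num.sqrt (m G x))^-1); apply: cvgM => //; exact: cvg_cst.
apply: (squeeze_cvgr _ (cvg_cst 0) c0); near=> h.
rewrite normr_ge0 /=.
have /(l2_pointwise x) : l2 G (u h - f) by near: h.
by [].
Unshelve. all: by end_near. Qed.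

End SquareSummable.

(** * Right derivatives and a one-sided Gronwall inequality *)

Section RightDerivative.
Context {R : realType}.
Implicit Types (p q : R -> R) (t c d T : R).

(** One-sided because the semigroup lives on nonnegative times and its generator is a limit as [h]
    decreases to 0. *)
Definition right_deriv q t d :=
  h^-1 * (q (t + h) - q t) @[h --> 0^'+] --> d.

Lemma right_deriv_cont q t d : right_deriv q t d ->
  q (t + h) @[h --> 0^'+] --> q t.
Proof.
move=> qd.
have h0 : (h : R) @[h --> 0^'+] --> (0 : R).
  by apply: cvg_at_right_filter; exact: cvg_id.
have lim : q t + h * (h^-1 * (q (t + h) - q t)) @[h --> 0^'+] --> q t.
  rewrite -[X in _ --> X]addr0 -[X in _ --> _ + X](mul0r d).
  exact: cvgD (cvg_cst _) (cvgM h0 qd).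
apply: cvg_trans lim; apply: near_eq_cvg; near=> h => /=.
have hn0 : h != 0 by rewrite gt_eqF//; near: h; exact: nbhs_right_gt.
by rewrite /= mulrA divff// mul1r subrKC.
Unshelve. all: by end_near. Qed.

Lemma right_derivD p q t c d : right_deriv p t c -> right_deriv q t d ->
  right_deriv (fun t => p t + q t) t (c + d).
Proof.
rewrite /right_deriv => pc qd; apply: cvg_trans (cvgD pc qd).
apply: near_eq_cvg; near=> h => /=.
by rewrite ?fctE; ring.
Unshelve. all: by end_near. Qed.

Lemma right_derivM p q t c d : right_deriv p t c -> right_deriv q t d ->
  right_deriv (fun t => p t * q t) t (c * q t + p t * d).
Proof.
move=> pc qd.
rewrite /right_deriv.
have lim : h^-1 * (p (t + h) - p t) * q (t + h) + p t * (h^-1 * (q (t + h) - q t))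
    @[h --> 0^'+] --> c * q t + p t * d.
  apply: cvgD; first exact: cvgM pc (right_deriv_cont qd).
  by apply: cvgM qd; exact: cvg_cst.
apply: cvg_trans lim; apply: near_eq_cvg; near=> h => /=.
by rewrite ?fctE; ring.
Unshelve. all: by end_near. Qed.

Lemma right_deriv_cst c t : right_deriv (fun=> c) t 0.
Proof.
rewrite /right_deriv; under eq_fun do rewrite subrr mulr0; exact: cvg_cst.
Qed.

Lemma right_derivZ a q t d : right_deriv q t d ->
  right_deriv (fun t => a * q t) t (a * d).
Proof.
move=> qd; have := right_derivM (right_deriv_cst a t) qd.
by rewrite mul0r add0r.
Qed.

Lemma right_derivB p q t c d : right_deriv p t c -> right_deriv q t d ->
  right_deriv (fun t => p t - q t) t (c - d).
Proof.
move=> pc qd; rewrite -mulN1r; under eq_fun do rewrite -mulN1r.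
exact: (right_derivD pc (right_derivZ (a := -1) qd)).
Qed.

Lemma right_deriv_sum (I : Type) (s : seq I) (u : I -> R -> R) (du : I -> R) t :
  (forall i, right_deriv (u i) t (du i)) ->
  right_deriv (fun t => \sum_(i <- s) u i t) t (\sum_(i <- s) du i).
Proof.
move=> h; elim: s => [|i s IHs].
  by under eq_fun do rewrite big_nil; rewrite big_nil; exact: right_deriv_cst.
by under eq_fun do rewrite big_cons; rewrite big_cons; exact: (right_derivD (h i) IHs).
Qed.

Lemma right_deriv_expR c t : right_deriv (fun t => expR (c * t)) t (c * expR (c * t)).
Proof.
have dZ : is_derive t 1 ( *%R c : R -> R) (c *: 1).
  by apply: is_deriveZ.
have d := is_derive1_comp (is_derive_expR (c * t)) dZ.
have := @ex_derive _ _ _ _ _ _ _ d; rewrite /derivable => cvd.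
have vd := @derive_val _ _ _ _ _ _ _ d.
have lim : h^-1 *: (((expR \o *%R c) \o shift t) (h *: 1) - (expR \o *%R c) t)
    @[h --> 0^'] --> c * expR (c * t).
  rewrite -[c * expR _](_ : 'D_1 (expR \o *%R c) t = _) //.
  by rewrite vd /GRing.scale /= mulr1 mulrC.
apply: cvg_trans (cvg_dnbhs_at_right lim); apply: near_eq_cvg; near=> h => /=.
by rewrite /GRing.scale /= mulr1 (addrC h).
Unshelve. all: by end_near. Qed.

Lemma right_deriv_le0 q t d : right_deriv q t d ->
  (forall s, t <= s -> q s <= q t) -> d <= 0.
Proof.
move=> qd qle; apply: (cvgr_to_le qd); near=> h.
have h0 : 0 < h by near: h; exact: nbhs_right_gt.
by rewrite pmulr_rle0 ?invr_gt0// subr_le0 qle// lerDl ltW.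
Unshelve. all: by end_near. Qed.

(* The comparison function solves b' = C b + D with b 0 = 0. *)
Lemma right_gronwall (q : R -> R) (T C D : R) : 0 < C -> 0 < D -> q 0 <= 0 ->
  (forall t0 : R, 0 <= t0 -> q t @[t --> within [set t | 0 <= t] (nbhs t0)] --> q t0) ->
  (forall t, 0 <= t <= T ->
     \forall h \near 0^'+, q (t + h) <= q t + h * (C * q t + D)) ->
  forall t, 0 <= t <= T -> q t <= D / C * (expR (C * t) - 1).
Proof.
move=> C0 D0 q0 qcont qstep t1 /andP[t10 t1T].
set b := fun t => D / C * (expR (C * t) - 1).
change (q t1 <= b t1).
rewrite leNgt; apply/negP => bad1.
(* The bound [expR x >= 1 + x] makes [b] dominate its own Euler step. *)
have bstep t h : 0 <= h -> q t <= b t ->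
    q t + h * (C * q t + D) <= b (t + h).
  move=> h0 qb.
  apply: (@le_trans _ _ (b t + h * (C * b t + D))).
    by rewrite lerD// ler_wpM2l// lerD2r ler_wpM2l// ltW.
  have -> : b (t + h) = b t + D / C * expR (C * t) * (expR (C * h) - 1).
    by rewrite /b (mulrDr C) expRD; ring.
  rewrite lerD2l.
  have -> : h * (C * b t + D) = D / C * expR (C * t) * (C * h).
    by rewrite /b; field; rewrite gt_eqF.
  apply: ler_wpM2l; last by rewrite lerBrDl expR_ge1Dx.
  by rewrite mulr_ge0 ?expR_ge0// divr_ge0 ?ltW.
(* The bad times; the contradiction arises at their infimum [i]. *)
pose B := [set t | 0 <= t <= t1 /\ b t < q t].
have Bt1 : B t1 by rewrite /B /= t10 lexx.
have lbB : lbound B 0 by move=> t [/andP[]].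
have infB : has_inf B by split; [exists t1|exists 0].
set i := inf B.
have i0 : 0 <= i by apply: lb_le_inf lbB; exists t1.
have it1 : i <= t1 by apply: ge_inf => //; exists 0.
have good s : 0 <= s < i -> q s <= b s.
  move=> /andP[s0 si]; rewrite leNgt; apply/negP => bad.
  suff : i <= s by rewrite leNgt si.
  apply: ge_inf; first by exists 0.
  by split => //; rewrite s0 (le_trans (ltW si)).
(* If [i] were bad, continuity would make the times just to its left bad as well, although all times
   before [i] are good; and 0 is good since [b 0 = 0]. *)
have goodi : q i <= b i.
  rewrite leNgt; apply/negP => badi.
  have ipos : 0 < i.
    rewrite lt_neqAle i0 andbT; apply: contraTneq badi => <-.
    by rewrite -leNgt /b mulr0 expR0 subrr mulr0.
  have bcont : b t @[t --> within [set t | 0 <= t] (nbhs i)] --> b i.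
    apply: cvg_within_filter.
    apply: cvgM; first exact: cvg_cst.
    apply: cvgB; last exact: cvg_cst.
    apply: (@cvg_comp _ _ _ ( *%R C) expR _ (nbhs (C * i))); last exact: continuous_expR.
    by apply: cvgM; [exact: cvg_cst|exact: cvg_id].
  have qb0 : 0 < q i - b i by rewrite subr_gt0.
  have := @cvgr_gt _ _ _ _ _ _ (cvgB (qcont i i0) bcont) _ qb0.
  rewrite near_withinE => near_bad.
  have near_left : \forall s \near i^'-, 0 <= s -> 0 < q s - b s.
    by rewrite near_withinE; near=> s => _; near: s; exact: near_bad.
  have : \forall s \near i^'-, False.
    near=> s.
    have si : s < i by near: s; exact: nbhs_left_lt.
    have s0 : 0 <= s by near: s; exact: nbhs_left_ge.
    have : 0 < q s - b s by move: s0; near: s.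
    by rewrite subr_gt0 ltNge good// s0.
  by move/filter_ex => [].
(* The step inequality at [i] holds on a whole right neighbourhood, which contains a bad time
   because [i] is the infimum. *)
have [e /= e0 he] := qstep i (introT andP (conj i0 (le_trans it1 t1T))).
have [s [/andP[s0 st1] bads] sie] := inf_adherent e0 infB.
have is_ : i <= s by apply: ge_inf; [exists 0|split => //; rewrite s0].
have [eis|nis] := eqVneq i s; first by move: bads; rewrite -eis ltNge goodi.
have ltis : i < s by rewrite lt_neqAle nis.
have qs : q s <= q i + (s - i) * (C * q i + D).
  have := he (s - i); rewrite /= subrKC sub0r normrN gtr0_norm ?subr_gt0// ltrBlDl.
  exact.
have := bstep i (s - i) _ goodi; rewrite subr_ge0 subrKC => /(_ is_) bs.
by move: bads; rewrite ltNge (le_trans qs bs).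
Unshelve. all: by end_near. Qed.

End RightDerivative.

(** * From the abstract semigroup to the pointwise heat equation *)

Section HeatSemigroup.
Context {R : realType} {V : choiceType} (G : weighted_graph R V).
Implicit Types (f g h : V -> R) (x y : V) (s : seq V).

Lemma l2dot_seq s f g : uniq s -> (forall x, g x != 0 -> x \in s) ->
  l2dot G f g = \sum_(x <- s) m G x * (f x * g x).
Proof.
move=> us hs; apply: rsum_seq => // x.
by rewrite !mulf_eq0 !negb_or => /and3P[_ _ /hs].
Qed.

Lemma energy_seq s f g : uniq s ->
  (forall x, g x != 0 -> x \in s /\ {subset nbr G x <= s}) ->
  energy G f g = - \sum_(x <- s) g x * (m G x * Delta G f x).
Proof.
move=> us hs; rewrite green// opprK /energy; congr (_ * _).
rewrite (@rsum_seq _ _ [seq (x, y) | x <- s, y <- s]); last 2 first.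
- by apply: allpairs_uniq => // -[? ?] [? ?].
- move=> [x y] /=; rewrite !mulf_eq0 !negb_or !subr_eq0 => /and3P[muxy _ gyx].
  have exy : edge G x y by apply: contra_neqT muxy => /mu_eq0.
  have nx : g x != 0 -> x \in s /\ y \in s.
    by move=> /hs[xs nxs]; split=> //; apply: nxs; rewrite mem_nbr.
  have ny : g y != 0 -> x \in s /\ y \in s.
    by move=> /hs[ys nys]; split=> //; apply: nys; rewrite mem_nbr edge_sym.
  have [xs ys] : x \in s /\ y \in s.
    have [gx0|/nx//] := eqVneq (g x) 0.
    by apply: ny; rewrite -gx0.
  by apply/allpairsP; exists (x, y).
by rewrite big_allpairs.
Qed.

Lemma C0_domQ f : C0 f -> domQ G f.
Proof.
move=> f0 e e0; exists f => //; rewrite subrr /Qnormsq /l2sq.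
rewrite esum1 ?esum1 ?mule0 ?adde0 ?lte_fin// => x _ /=.
- by rewrite subrr expr0n mulr0.
- by rewrite expr0n mulr0.
Qed.

Section Generator.
Context (L : @operator R V) (genL : is_form_generator G L).

(** With [S] the square root of [-L], self-adjointness gives [<-L f, g> = <S f, S g>], which is the
    energy of [f] and [g], and Green's formula moves all differences onto [f]. *)
Lemma generator_weak f g s : dom L f -> uniq s ->
  (forall x, g x != 0 -> x \in s /\ {subset nbr G x <= s}) ->
  \sum_(x <- s) m G x * (act L f x * g x) =
  \sum_(x <- s) g x * (m G x * Delta G f x).
Proof.
move=> domf us hs.
have gs x : g x != 0 -> x \in s by move=> /hs[].
have g0 : C0 g by apply: C0_seq gs.
case: genL => _ _ [S [[[_ _ Ssa] _ Sdom Sact] SQ QE]].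
have [domSf domSSf] := (Sdom f).1 domf.
have Qg : dom S g by rewrite SQ; apply: C0_domQ.
have [_ _ Sg] := (Ssa g (act S g)).1 (conj Qg erefl).
have e1 : l2dot G (act (opp_operator L) f) g = energy G f g.
  rewrite -Sact// Sg// QE -?SQ//.
have := e1; rewrite (l2dot_seq _ us gs) (energy_seq _ us hs) => e2.
apply: oppr_inj; rewrite -e2 -sumrN; apply: eq_bigr => x _ /=.
by rewrite mulNr mulrN.
Qed.

(** The weak identity is tested against the indicator of [x]. *)
Lemma generator_Delta f : dom L f -> act L f = Delta G f.
Proof.
move=> domf; apply/funext => x.
have hs y : (y == x)%:R != 0 :> R ->
    y \in hull G [:: x] /\ {subset nbr G y <= hull G [:: x]}.
  by rewrite pnatr_eq0 eqb0 negbK => /eqP ->; split;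
    [apply: sub_hull|apply: nbr_hull]; rewrite inE.
have us := hull_uniq G [:: x].
have := generator_weak domf us hs.
have xs : x \in hull G [:: x] by apply: sub_hull; rewrite inE.
rewrite (bigD1_seq x)//= big1 ?(bigD1_seq x)//= ?big1.
- by rewrite eqxx !addr0 mulr1 mul1r => /mulfI; apply; exact: m_neq0.
- by move=> y /negbTE ->; rewrite mul0r.
- by move=> y /negbTE ->; rewrite !mulr0.
Qed.

(** By the weak identity and the symmetry of [Delta], the pair [(f, Delta G f)] lies in the graph of
    the adjoint of [L], which is [L] itself. *)
Lemma C0_generator f : C0 f -> dom L f.
Proof.
move=> f0; have [s us hs] := C0_surround G f0.
case: genL => -[_ _ sa] _ _; apply: ((sa f (Delta G f)).2 _).1.
split; [exact: C0_l2|exact/C0_l2/C0_Delta|] => h domh.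
rewrite (l2dot_seq _ us); last by move=> x /hs[].
rewrite (generator_weak domh us hs) Delta_sym// (l2dot_seq _ us).
  by apply: eq_bigr => x _; rewrite mulrCA.
exact: Delta_support.
Qed.

End Generator.

Section Semigroup.
Context (P : R -> (V -> R) -> V -> R) (heatP : is_heat_semigroup G P).

Lemma heat_C0_l2 f t : C0 f -> 0 <= t -> l2 G (P t f).
Proof.
move=> f0 t0; case: heatP => L _ [Pb _ _ _ _].
by have [+ _ _] := Pb t t0; apply; apply: C0_l2.
Qed.

Lemma heat0 f : C0 f -> P 0 f = f.
Proof. by move=> f0; case: heatP => L _ [_ + _ _ _]; apply; apply: C0_l2. Qed.

(** [P t] is bounded and commutes with [P h], so it carries the difference quotient of [f] at time 0
    to the one at time [t]. The limit found this way puts [P t f] in the domain of [L], where [L]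
    acts as [Delta]. *)
Lemma heat_deriv_l2 f t : C0 f -> 0 <= t ->
  P t (Delta G f) = Delta G (P t f) /\
  l2norm G (h^-1 *: (P (t + h) f - P t f) - Delta G (P t f)) @[h --> 0^'+]
    --> (0 : R).
Proof.
move=> f0 t0; case: heatP => L genL [Pb P0 PD Pc PL].
have lf := C0_l2 G f0.
have lDf := C0_l2 G (C0_Delta G f0).
have domf := C0_generator genL f0.
have [Pl2 Plin [C PC]] := Pb t t0.
have [_ _ Lf] := (PL f (Delta G f)).1 (conj domf (generator_Delta genL domf)).
have key : l2norm G (h^-1 *: (P h (P t f) - P t f) - P t (Delta G f))
    @[h --> 0^'+] --> (0 : R).
  have C0' : C * l2norm G (h^-1 *: (P h f - f) - Delta G f) @[h --> 0^'+] --> (0 : R).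
    by rewrite -[X in _ --> X](mulr0 C); apply: cvgM => //; exact: cvg_cst.
  apply: (squeeze_cvgr _ (cvg_cst 0) C0'); near=> h.
  have h0 : 0 <= h by apply/ltW; near: h; exact: nbhs_right_gt.
  have lPh : l2 G (P h f) by have [+ _ _] := Pb h h0; apply.
  have -> : P h (P t f) = P t (P h f) by rewrite -!PD// (addrC t h).
  have -> : h^-1 *: (P t (P h f) - P t f) - P t (Delta G f) =
      P t (h^-1 *: (P h f - f) - Delta G f).
    have PB u v : l2 G u -> l2 G v -> P t (u - v) = P t u - P t v.
      by move=> lu lv; rewrite addrC -scaleN1r Plin// scaleN1r addrC.
    have PZ a u : l2 G u -> P t (a *: u) = a *: P t u.
      move=> lu; rewrite -[a *: u]addr0 -(subrr u) Plin//; last exact: l2B.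
      by rewrite PB// subrr addr0.
    by rewrite PB ?PZ ?PB//; [exact: l2B|apply/l2Z/l2B].
  rewrite sqrtr_ge0 /=; apply: PC; apply: l2B => //.
  exact/l2Z/l2B.
have [domPf LPf] := (PL (P t f) (P t (Delta G f))).2
   (And3 (Pl2 _ lf) (Pl2 _ lDf) key).
have e : P t (Delta G f) = Delta G (P t f).
  by rewrite -LPf (generator_Delta genL).
split=> //; rewrite -e; apply: cvg_trans key.
apply: near_eq_cvg; near=> h.
have h0 : 0 <= h by apply/ltW; near: h; exact: nbhs_right_gt.
by rewrite (addrC t h) PD.
Unshelve. all: by end_near. Qed.

Lemma heat_Delta f t : C0 f -> 0 <= t -> P t (Delta G f) = Delta G (P t f).
Proof. by move=> f0 t0; case: (heat_deriv_l2 f0 t0). Qed.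

Lemma heat_right_deriv f t x : C0 f -> 0 <= t ->
  right_deriv (fun t => P t f x) t (Delta G (P t f) x).
Proof.
move=> f0 t0; have [e lim0] := heat_deriv_l2 f0 t0.
apply: (l2_cvg_pointwise _ lim0); near=> h.
have h0 : 0 <= h by apply/ltW; near: h; exact: nbhs_right_gt.
apply: l2B; last by rewrite -e; apply: heat_C0_l2 => //; exact: C0_Delta.
by apply/l2Z/l2B; apply: heat_C0_l2 => //; rewrite addr_ge0.
Unshelve. all: by end_near. Qed.

Lemma heat_cont_l2 f (t0 : R) : C0 f -> 0 <= t0 ->
  l2norm G (P t f - P t0 f) @[t --> within [set t | 0 <= t] (nbhs t0)]
    --> (0 : R).
Proof.
by move=> f0 t00; case: heatP => L _ [_ _ _ + _]; apply => //; exact: C0_l2.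
Qed.

Lemma heat_cont f (t0 : R) x : C0 f -> 0 <= t0 ->
  P t f x @[t --> within [set t | 0 <= t] (nbhs t0)] --> P t0 f x.
Proof.
move=> f0 t00.
apply: (l2_cvg_pointwise _ (heat_cont_l2 f0 t00)).
rewrite near_withinE; near=> t => /= t_ge0.
by apply: l2B; exact: heat_C0_l2.
Unshelve. all: by end_near. Qed.

(** Norm continuity bounds the norm near each time, and compactness of the interval makes the bound
    uniform. *)
Lemma heat_bounded f (T : R) : C0 f ->
  exists M : R, forall t, 0 <= t <= T -> l2norm G (P t f) ^+ 2 <= M.
Proof.
move=> f0.
have cpt := (compact_near_coveringP `[0, T]).1 (segment_compact (a := 0) (b := T)).
have : \forall M \near +oo, `[0, T] `<=`
    (fun t => 0 <= t -> l2norm G (P t f) ^+ 2 <= M).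
  apply: cpt => t0; rewrite /= in_itv /= => /andP[t00 _].
  have := @cvgr_dist_lt _ _ _ _ _ _ _ (heat_cont_l2 f0 t00) 1 ltr01.
   rewrite near_withinE => near1.
  near=> t M => /= t_ge0.
  have lt1 : `|0 - l2norm G (P t f - P t0 f)| < 1.
    move: t_ge0; near: t; exact: near1.
  (* Near [t0] the distance to [P t0 f] is below 1, so the squared norm is at most twice 1 plus
     twice the squared norm at [t0]. *)
  have M_ge : 2 + 2 * l2norm G (P t0 f) ^+ 2 <= M.
    by near: M; apply: nbhs_pinfty_ge; exact: num_real.
  apply: le_trans M_ge.
  apply: (le_trans (l2norm_sqrD (heat_C0_l2 f0 t_ge0) (heat_C0_l2 f0 t00))).
  rewrite lerD2r -[leRHS]mulr1 ler_wpM2l// expr_le1 ?sqrtr_ge0//.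
  by move: lt1; rewrite sub0r normrN ger0_norm ?sqrtr_ge0// => /ltW.
move=> [M [_ hM]]; exists (M + 1) => t /andP[t0 tT].
by apply: (hM (M + 1)) => //=; rewrite ?ltrDl// in_itv /= t0.
Unshelve. all: by end_near. Qed.

End Semigroup.
End HeatSemigroup.

(** * Energy estimates with cut-off functions *)

Section Cutoff.
Context {R : realType} {V : choiceType} (G : weighted_graph R V).
Implicit Types (f g h u v p eta : V -> R) (x y : V) (s : seq V).

(* Pairing [eta^2 p] with [Delta v] costs only [Gamma eta], because
   (eta_y^2 p_y - eta_x^2 p_x) (p_y - p_x)
     = (eta_y p_y - eta_x p_x)^2 - p_x p_y (eta_y - eta_x)^2;
   [e] is a lower bound for what remains edgewise. *)
Lemma cutoff_Delta_le s eta v p (e : V -> V -> R) : uniq s ->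
  (forall x, eta x != 0 -> x \in s /\ {subset nbr G x <= s}) ->
  (forall x y, e x y - 2^-1 * (p x ^+ 2 + p y ^+ 2) * (eta y - eta x) ^+ 2 <=
     (v y - v x) * (eta y ^+ 2 * p y - eta x ^+ 2 * p x)) ->
  \sum_(x <- s) eta x ^+ 2 * p x * (m G x * Delta G v x) <=
  \sum_(x <- s) m G x * p x ^+ 2 * Gamma G eta eta x
  - 2^-1 * \sum_(x <- s) \sum_(y <- s) mu G x y * e x y.
Proof.
move=> us hs he.
rewrite (@green _ _ G s v (fun x => eta x ^+ 2 * p x))//; last first.
  by move=> x; rewrite mulf_eq0 expf_eq0 /= negb_or => /andP[/hs].
have sumE : \sum_(x <- s) \sum_(y <- s)
      mu G x y * (2^-1 * (p x ^+ 2 + p y ^+ 2) * (eta y - eta x) ^+ 2) =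
    \sum_(x <- s) p x ^+ 2 * \sum_(y <- s) mu G x y * (eta y - eta x) ^+ 2.
  (* The weight is split into its [p x] and [p y] halves; exchanging the variables in the second
     half leaves only [p x]. *)
  pose w x y := 2^-1 * (mu G x y * (p x ^+ 2 * (eta y - eta x) ^+ 2)).
  transitivity (\sum_(x <- s) \sum_(y <- s) (w x y + w y x)).
    apply: eq_bigr => x _; apply: eq_bigr => y _.
    by rewrite /w (mu_sym G y x); field.
  under eq_bigr do rewrite big_split /=.
  rewrite big_split /= [X in _ + X]exchange_big /= -big_split /=.
  apply: eq_bigr => x _; rewrite -big_split mulr_sumr; apply: eq_bigr => y _ /=.
  by rewrite /w; field.
have le1 : \sum_(x <- s) p x ^+ 2 * \sum_(y <- s) mu G x y * (eta y - eta x) ^+ 2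
    <= 2 * \sum_(x <- s) m G x * p x ^+ 2 * Gamma G eta eta x.
  rewrite mulr_sumr; apply: ler_sum => x _.
  rewrite [leRHS](_ : _ = p x ^+ 2 * (2 * m G x * Gamma G eta eta x)); last ring.
  by rewrite ler_wpM2l ?sqr_ge0// sum_le_Gamma.
have le2 : \sum_(x <- s) \sum_(y <- s) mu G x y * e x y -
    \sum_(x <- s) \sum_(y <- s)
      mu G x y * (2^-1 * (p x ^+ 2 + p y ^+ 2) * (eta y - eta x) ^+ 2) <=
    \sum_(x <- s) \sum_(y <- s)
      mu G x y * ((v y - v x) * (eta y ^+ 2 * p y - eta x ^+ 2 * p x)).
  rewrite -sumrB; apply: ler_sum => x _; rewrite -sumrB; apply: ler_sum => y _.
  by rewrite -mulrBr ler_wpM2l ?mu_ge0.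
move: le2; rewrite sumE.
set A := \sum_(x <- s) \sum_(y <- s) mu G x y * e x y.
set B := \sum_(x <- s) \sum_(y <- s) mu G x y * ((v y - v x) * _).
set E1 := \sum_(x <- s) p x ^+ 2 * _ in le1 *.
set E2 := \sum_(x <- s) m G x * _ * _ in le1 *.
by lra.
Qed.

Definition pos_part v x : R := Num.max (v x) 0.

(** Writing [p] for the positive part, [p * (p - v) = 0] and [p - v >= 0], so replacing [v] by [p]
    in the difference [v y - v x] only decreases the edge term. For [p] itself the edge identity of
    the cut-off estimate applies, with remainder bound [e = 0]. *)
Lemma pos_part_Delta_le s eta v : uniq s ->
  (forall x, eta x != 0 -> x \in s /\ {subset nbr G x <= s}) ->
  \sum_(x <- s) eta x ^+ 2 * pos_part v x * (m G x * Delta G v x) <=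
  \sum_(x <- s) m G x * pos_part v x ^+ 2 * Gamma G eta eta x.
Proof.
move=> us hs; pose e (x y : V) : R := 0.
have := @cutoff_Delta_le s eta v (pos_part v) e us hs.
rewrite [X in _ - 2^-1 * X]big1 ?mulr0 ?subr0; last first.
  by move=> x _; rewrite big1// => y _; rewrite mulr0.
apply=> x y; rewrite /e sub0r /pos_part.
have key (a b c d : R) : 0 <= (c ^+ 2) * (Num.max a 0) * (Num.max b 0 - b) ->
    0 <= (d ^+ 2) * (Num.max b 0) * (Num.max a 0 - a) ->
    Num.max a 0 * (Num.max a 0 - a) = 0 -> Num.max b 0 * (Num.max b 0 - b) = 0 ->
    - (2^-1 * (Num.max a 0 ^+ 2 + Num.max b 0 ^+ 2) * (d - c) ^+ 2) <=
    (b - a) * (d ^+ 2 * Num.max b 0 - c ^+ 2 * Num.max a 0).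
  set pa := Num.max a 0; set pb := Num.max b 0 => h1 h2 h3 h4.
  rewrite -subr_ge0.
  have -> : (b - a) * (d ^+ 2 * pb - c ^+ 2 * pa)
      - - (2^-1 * (pa ^+ 2 + pb ^+ 2) * (d - c) ^+ 2) =
    c ^+ 2 * pa * (pb - b) + d ^+ 2 * pb * (pa - a)
    - c ^+ 2 * (pa * (pa - a)) - d ^+ 2 * (pb * (pb - b))
    + ((d * pb - c * pa) ^+ 2 + 2^-1 * (pa - pb) ^+ 2 * (d - c) ^+ 2) by field.
  rewrite h3 h4 !mulr0 !subr0 !addr_ge0// ?sqr_ge0//.
  by rewrite mulr_ge0 ?sqr_ge0// mulr_ge0 ?sqr_ge0.
have max_ge (a : R) : 0 <= Num.max a 0 - a by rewrite subr_ge0 le_max lexx.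
have max0 (a : R) : 0 <= Num.max a 0 by rewrite le_max lexx orbT.
have maxM (a : R) : Num.max a 0 * (Num.max a 0 - a) = 0.
  by case: (leP a 0) => _; rewrite ?mul0r// subrr mulr0.
by apply: key => //; apply: mulr_ge0 => //; apply: mulr_ge0 => //; exact: sqr_ge0.
Qed.

(** The Caccioppoli inequality: here [p = v = u], and the full square
    [(eta y * u y - eta x * u x) ^+ 2] is retained as [e]. *)
Lemma sum_Gamma_cutoff_le s F eta u : uniq s -> uniq F ->
  (forall x, eta x != 0 -> x \in s /\ {subset nbr G x <= s}) ->
  (forall x, x \in F -> x \in s /\ {subset nbr G x <= s}) ->
  \sum_(x <- F) m G x * Gamma G (eta \* u) (eta \* u) x <=
  \sum_(x <- s) m G x * u x ^+ 2 * Gamma G eta eta x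
  - \sum_(x <- s) eta x ^+ 2 * u x * (m G x * Delta G u x).
Proof.
move=> us uF hs hF.
pose e x y := (eta y * u y - eta x * u x) ^+ 2.
have := @cutoff_Delta_le s eta u u e us hs.
move=> /(_ _) h; rewrite lerBrDl -lerBrDr.
apply: le_trans (h _) _ => [x y|].
  rewrite -subr_ge0 [leRHS](_ : _ = 2^-1 * (u x - u y) ^+ 2 * (eta y - eta x) ^+ 2).
    by rewrite mulr_ge0 ?sqr_ge0// mulr_ge0 ?sqr_ge0.
  by rewrite /e; field.
rewrite lerD2l lerN2 mulr_sumr.
(* Vertices outside [F] are dropped. On [F] all neighbours lie in [s], so the inner sum is exactly
   the one in [Gamma]. *)
apply: (@le_trans _ _ (\sum_(x <- F) 2^-1 * \sum_(y <- s) mu G x y * e x y)).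
  rewrite le_eqVlt; apply/orP; left; apply/eqP/eq_big_seq => x xF.
  have [xs nxs] := hF x xF.
  have := Gamma_seq (eta \* u) (eta \* u) us nxs.
  under [X in _ = X]eq_bigr do rewrite -expr2.
  by rewrite /e /= => <-; field.
rewrite [leRHS](bigID (mem F)) /= -[X in _ <= X + _]big_filter.
rewrite (@eq_big_support _ _ F [seq x <- s | x \in F])//; last 2 first.
- by rewrite filter_uniq.
- move=> x _; rewrite mem_filter.
  by case: (boolP (x \in F)) => //= /hF[-> _].
rewrite lerDl sumr_ge0// => x _; rewrite mulr_ge0 ?invr_ge0//.
by apply: sumr_ge0 => y _; rewrite mulr_ge0 ?mu_ge0 ?sqr_ge0.
Qed.

(** The embedding of l1 into l2 for counting measure: the cross terms are nonnegative. *)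
Lemma sum_sqr_le (s : seq V) (a : V -> R) : (forall x, 0 <= a x) ->
  \sum_(x <- s) a x ^+ 2 <= (\sum_(x <- s) a x) ^+ 2.
Proof.
move=> a0; elim: s => [|x s IHs]; first by rewrite !big_nil expr0n.
rewrite !big_cons sqrrD -addrA lerD2l (le_trans IHs)// lerDr.
by rewrite mulrn_wge0// mulr_ge0// sumr_ge0.
Qed.

(** * Consequences of completeness *)

Section Exhaustion.
Context (eta : nat -> V -> R) (eta_C0 : forall k, C0 (eta k))
  (eta_mono : forall k x, eta k x <= eta k.+1 x)
  (eta_cvg : forall x, eta k x @[k --> \oo] --> (1 : R))
  (eta_Gamma : forall k x, Gamma G (eta k) (eta k) x <= k.+1%:R^-1).

(** The sequence increases to 1, which bounds it above. Below it is bounded by its first function,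
    which is finitely supported; no sign is assumed on it. *)
Lemma eta_bounded : exists2 B : R, 0 <= B & forall k x, eta k x ^+ 2 <= B.
Proof.
have [s us hs] := C0P (eta_C0 0).
pose b := \sum_(x <- s) `|eta 0 x|.
have b_ge0 : 0 <= b by apply: sumr_ge0.
have eta_lb x : - b <= eta 0 x.
  rewrite lerNl; have [xs|] := boolP (x \in s).
    rewrite /b (bigD1_seq x)//= -[leLHS]addr0 lerD ?sumr_ge0//.
    by rewrite -normrN ler_norm.
  by move=> xs; rewrite (contraNeq (hs x) xs) oppr0.
exists ((1 + b) ^+ 2) => [|k x]; first exact: sqr_ge0.
rewrite -[leLHS]real_normK ?num_real// lerXn2r ?nnegrE ?addr_ge0// ler_norml.
have nd : nondecreasing_seq (eta ^~ x) by apply/nondecreasing_seqP => n.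
apply/andP; split.
  apply: le_trans (le_trans (eta_lb x) (nd 0%N k (leq0n k))).
  by rewrite lerN2 lerDr.
have := nondecreasing_cvgn_le nd (cvgP _ (eta_cvg x)) k.
by rewrite (cvg_lim _ (eta_cvg x))// => /le_trans; apply; rewrite lerDl.
Qed.

(** The Caccioppoli inequality with cut-off [eta k], where [Gamma (eta k)] is at most 1 and the term
    in [u * Delta u] is absorbed by the two squares. The right side does not depend on [k], and the
    left side is a finite sum, so [k] may tend to infinity. *)
Lemma sum_Gamma_le (B : R) F u : uniq F -> 0 <= B ->
  (forall k x, eta k x ^+ 2 <= B) -> l2 G u -> l2 G (Delta G u) ->
  \sum_(x <- F) m G x * Gamma G u u x <=
  l2norm G u ^+ 2 + B * (l2norm G u ^+ 2 + l2norm G (Delta G u) ^+ 2).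
Proof.
move=> uF B0 hB lu lDu.
have lim : \sum_(x <- F) m G x * Gamma G (eta k \* u) (eta k \* u) x
    @[k --> \oo] --> \sum_(x <- F) m G x * Gamma G u u x.
  apply: cvg_big => [|x _]; first exact: add_continuous.
  apply: cvgM; first exact: cvg_cst.
  rewrite GammaE; under eq_fun do rewrite GammaE.
  apply: cvgM; first exact: cvg_cst.
  apply: cvg_big => [|y _]; first exact: add_continuous.
  apply: cvgM; first exact: cvg_cst.
  have c z : eta k z * u z @[k --> \oo] --> u z.
    rewrite -[X in _ --> X]mul1r; apply: cvgM; [exact: eta_cvg|exact: cvg_cst].
  by apply: cvgM; apply: cvgB; exact: c.
apply: (cvgr_to_le lim); near=> k.
have [s0 _ hs0] := C0P (eta_C0 k).
pose s := hull G (F ++ s0).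
have us : uniq s := hull_uniq G _.
have hF x : x \in F ++ s0 -> x \in s /\ {subset nbr G x <= s}.
  by move=> xF; split; [exact: sub_hull|exact: nbr_hull].
apply: le_trans (@sum_Gamma_cutoff_le s F (eta k) u us uF _ _) _.
- by move=> x /hs0 xs; apply: hF; rewrite mem_cat xs orbT.
- by move=> x xF; apply: hF; rewrite mem_cat xF.
rewrite lerD//.
  apply: le_trans (l2_seq lu us); apply: ler_sum => x _.
  rewrite -[leRHS]mulr1; apply: ler_wpM2l.
    by apply: mulr_ge0; [exact: ltW (m_gt0 G x)|exact: sqr_ge0].
  by apply: le_trans (eta_Gamma k x) _; rewrite invf_le1 ?ltr0n// ler1n.
apply: (@le_trans _ _ (B * (\sum_(x <- s) m G x * u x ^+ 2 +
    \sum_(x <- s) m G x * Delta G u x ^+ 2))); last first.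
  by rewrite ler_wpM2l// lerD// l2_seq.
rewrite -big_split mulr_sumr -sumrN; apply: ler_sum => x _ /=.
have mx := ltW (m_gt0 G x).
apply: (@le_trans _ _ (eta k x ^+ 2 * (m G x * u x ^+ 2 + m G x * Delta G u x ^+ 2))).
  rewrite -subr_ge0 [leRHS](_ : _ = eta k x ^+ 2 * (m G x *
      (2^-1 * (u x + Delta G u x) ^+ 2 + 2^-1 * (u x ^+ 2 + Delta G u x ^+ 2)))).
    apply: mulr_ge0; first exact: sqr_ge0.
    apply: mulr_ge0 => //; apply: addr_ge0; apply: mulr_ge0 => //.
      exact: sqr_ge0.
    by apply: addr_ge0; exact: sqr_ge0.
  by field.
apply: ler_wpM2r; last exact: hB.
by apply: addr_ge0; apply: mulr_ge0 => //; exact: sqr_ge0.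
Unshelve. all: by end_near. Qed.

End Exhaustion.
End Cutoff.

(** * The gradient estimate and its equivalence with the curvature bound *)

Section GradientEstimate.
Context {R : realType} {V : choiceType} (G : weighted_graph R V).
Implicit Types (f g h u v : V -> R) (x y : V) (s : seq V).

Lemma nondegenerate_lb : nondegenerate_measure G ->
  exists2 c : R, 0 < c & forall x, c <= m G x.
Proof.
rewrite /nondegenerate_measure => inf0.
have inf_le x : (ereal_inf (range (fun x => (m G x)%:E)) <= (m G x)%:E)%E.
  by apply: ereal_inf_lbound; exists x.
case: (ereal_inf _) inf0 inf_le => [c||] //= => [c0 cle|_ h].
  by exists c => // x; rewrite -lee_fin.
(* The infimum is +oo only when there is no vertex, and then any constant serves. *)
by exists 1 => // x; have := h x; rewrite leye_eq.
Qed.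

Lemma Delta_linB (c : R) f g x :
  Delta G (fun y => f y - c * g y) x = Delta G f x - c * Delta G g x.
Proof.
rewrite !DeltaE mulrCA -mulrBr; congr (_ * _); rewrite mulr_sumr -sumrB.
by apply: eq_bigr => y _; ring.
Qed.

Lemma right_deriv_Gamma (u : R -> V -> R) (du : V -> R) (t : R) x :
  (forall y, right_deriv (u ^~ y) t (du y)) ->
  right_deriv (fun t => Gamma G (u t) (u t) x) t (2 * Gamma G (u t) du x).
Proof.
move=> h.
rewrite [X in right_deriv X](_ : _ = fun t => (2 * m G x)^-1 *
  \sum_(y <- nbr G x) mu G x y * ((u t y - u t x) * (u t y - u t x))); last first.
  by apply/funext => r; rewrite GammaE.
rewrite GammaE mulrCA; apply/right_derivZ; rewrite mulr_sumr.
apply/right_deriv_sum => y; rewrite mulrCA; apply/right_derivZ.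
have hB := right_derivB (h y) (h x).
have := right_derivM hB hB.
rewrite [X in right_deriv _ _ X](_ : _ = 2 * ((u t y - u t x) * (du y - du x)))//.
by ring.
Qed.

Lemma cvg_Gamma (T : Type) (F : set_system T) {FF : Filter F} (u : T -> V -> R) f x :
  (forall y, u t y @[t --> F] --> f y) ->
  Gamma G (u t) (u t) x @[t --> F] --> Gamma G f f x.
Proof.
move=> h; rewrite GammaE; under eq_fun do rewrite GammaE.
apply: cvgM; first exact: cvg_cst.
apply: cvg_big => [|y _]; first exact: add_continuous.
apply: cvgM; first exact: cvg_cst.
by apply: cvgM; apply: cvgB; exact: h.
Qed.

Section Flow.
Context (K : R) (P : R -> (V -> R) -> V -> R) (heatP : is_heat_semigroup G P).
Context (f : V -> R) (f0 : C0 f).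

Definition gradient_defect (t : R) x :=
  Gamma G (P t f) (P t f) x - expR (- (2 * K * t)) * P t (Gamma G f f) x.

Definition gradient_defect_deriv (t : R) x :=
  2 * Gamma G (P t f) (Delta G (P t f)) x +
  expR (- (2 * K * t)) *
    (2 * K * P t (Gamma G f f) x - Delta G (P t (Gamma G f f)) x).

Local Notation v := gradient_defect.
Local Notation dv := gradient_defect_deriv.

Lemma gradient_defect_right_deriv (t : R) x : 0 <= t -> right_deriv (v ^~ x) t (dv t x).
Proof.
move=> t0; have g0 := C0_Gamma G f0.
have e' : right_deriv (fun t => expR (- (2 * K * t))) t
    (- (2 * K) * expR (- (2 * K * t))).
  have -> : (fun t => expR (- (2 * K * t))) = (fun t => expR (- (2 * K) * t)).
    by apply/funext => r; rewrite mulNr.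
  by rewrite -(mulNr _ t); exact: (@right_deriv_expR R (- (2 * K)) t).
have w' : right_deriv (fun t => P t (Gamma G f f) x) t _ := heat_right_deriv heatP g0 t0.
have u' y : right_deriv (fun t => P t f y) t _ := heat_right_deriv heatP f0 t0.
rewrite /dv [X in right_deriv _ _ X](_ : _ = 2 * Gamma G (P t f) (Delta G (P t f)) x -
  (- (2 * K) * expR (- (2 * K * t)) * P t (Gamma G f f) x +
   expR (- (2 * K * t)) * Delta G (P t (Gamma G f f)) x)); last ring.
exact: (right_derivB (right_deriv_Gamma u') (right_derivM e' w')).
Qed.

Lemma gradient_defect_cont (t0 : R) x : 0 <= t0 ->
  v t x @[t --> within [set t | 0 <= t] (nbhs t0)] --> v t0 x.
Proof.
move=> t00; have g0 := C0_Gamma G f0.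
apply: cvgB.
  apply: (cvg_Gamma (u := fun t => P t f)) => y; exact: (heat_cont heatP f0 t00).
apply: cvgM; last exact: (heat_cont heatP g0 t00).
apply: cvg_within_filter.
apply: (@cvg_comp _ _ _ (fun t => - (2 * K * t)) expR _ (nbhs (- (2 * K * t0)))).
  by apply: cvgN; apply: cvgM; [exact: cvg_cst|exact: cvg_id].
exact: continuous_expR.
Qed.

Lemma gradient_defect0 x : v 0 x = 0.
Proof.
rewrite /v (heat0 heatP f0) (heat0 heatP (C0_Gamma G f0)).
by rewrite mulr0 oppr0 expR0 mul1r subrr.
Qed.

(** The curvature condition is applied to [P t f]: it bounds [2 * Gamma u (Delta u)] by
    [Delta (Gamma u) - 2 * K * Gamma u], while the terms in [P t (Gamma G f f)] agree on both
    sides. *)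
Lemma gradient_defect_subsolution t x : CD_infty G K ->
  dv t x <= Delta G (v t) x - 2 * K * v t x.
Proof.
move=> /(_ (P t f) x); rewrite /Gamma2 => cd.
rewrite Delta_linB /v /dv; lra.
Qed.

Section Bound.
Context (eta : nat -> V -> R) (eta_C0 : forall k, C0 (eta k))
  (eta_mono : forall k x, eta k x <= eta k.+1 x)
  (eta_cvg : forall x, eta k x @[k --> \oo] --> (1 : R))
  (eta_Gamma : forall k x, Gamma G (eta k) (eta k) x <= k.+1%:R^-1).

(** [P t (Gamma G f f)] is controlled in [l2] by [heat_bounded]. For [Gamma (P t f)] only an l1
    bound is available, and the lower bound [c] on the measure upgrades it to an [l2] bound. *)
Lemma gradient_defect_bounded T : nondegenerate_measure G ->
  exists2 M : R, 0 <= M & forall t s, 0 <= t <= T -> uniq s ->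
    \sum_(x <- s) m G x * v t x ^+ 2 <= M.
Proof.
move=> /nondegenerate_lb[c c0 cm].
have [B B0 hB] := eta_bounded eta_C0 eta_mono eta_cvg.
have [M1 hM1] := heat_bounded heatP T f0.
have [M2 hM2] := heat_bounded heatP T (C0_Delta G f0).
have [M3 hM3] := heat_bounded heatP T (C0_Gamma G f0).
(* The l1 bound on [Gamma (P t f)]; [M2] enters because [Delta (P t f)] is [P t (Delta f)]. *)
pose N := M1 + B * (M1 + M2).
pose E := expR (2 * `|K| * T) ^+ 2.
exists (`|2 * E * M3 + 2 * (c^-1 * N ^+ 2)|) => // t s tT us.
have /andP[t0 tleT] := tT.
apply: le_trans _ (ler_norm _).
have hE : expR (- (2 * K * t)) ^+ 2 <= E.
  rewrite lerXn2r ?nnegrE ?expR_ge0// ler_expR.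
  apply: (@le_trans _ _ (2 * `|K| * t)); last by rewrite ler_wpM2l ?mulr_ge0.
  by rewrite -mulNr ler_wpM2r// -mulrN ler_wpM2l// -normrN ler_norm.
have le1 : \sum_(x <- s) m G x * P t (Gamma G f f) x ^+ 2 <= M3.
  by apply: le_trans (hM3 t tT); apply: l2_seq => //; exact: heat_C0_l2 (C0_Gamma G f0) t0.
have le2 : \sum_(x <- s) m G x * Gamma G (P t f) (P t f) x ^+ 2 <= c^-1 * N ^+ 2.
  (* Since [c <= m G x], the weight [m G x] is at most [c^-1 * m G x ^+ 2]. *)
  apply: (@le_trans _ _ (c^-1 * (\sum_(x <- s) m G x * Gamma G (P t f) (P t f) x) ^+ 2)).
    apply: (@le_trans _ _ (c^-1 * \sum_(x <- s) (m G x * Gamma G (P t f) (P t f) x) ^+ 2)).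
      rewrite mulr_sumr; apply: ler_sum => x _.
      move: (Gamma G _ _ x) => gx.
      rewrite exprMn [leRHS]mulrA; apply: ler_wpM2r; first exact: sqr_ge0.
      rewrite expr2 mulrA ler_peMl ?(ltW (m_gt0 G x))//.
      by rewrite ler_pdivlMl// mulr1.
    rewrite ler_wpM2l ?invr_ge0 ?(ltW c0)// sum_sqr_le// => x.
    by rewrite mulr_ge0 ?Gamma_ge0// ltW// m_gt0.
  rewrite ler_wpM2l ?invr_ge0 ?(ltW c0)//.
  have sum0 : 0 <= \sum_(x <- s) m G x * Gamma G (P t f) (P t f) x.
    by apply: sumr_ge0 => x _; rewrite mulr_ge0 ?Gamma_ge0// ltW// m_gt0.
  have leN : \sum_(x <- s) m G x * Gamma G (P t f) (P t f) x <= N.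
    apply: le_trans (sum_Gamma_le eta_C0 eta_cvg eta_Gamma us B0 hB _ _) _.
    - exact: heat_C0_l2 f0 t0.
    - by rewrite -(heat_Delta heatP)//; exact: heat_C0_l2 (C0_Delta G f0) t0.
    - have l1 := hM1 t tT; have l2 := hM2 t tT.
      rewrite -(heat_Delta heatP f0 t0) /N; apply: lerD => //.
      by apply: ler_wpM2l => //; apply: lerD.
  by rewrite lerXn2r ?nnegrE// (le_trans sum0).
have := sum_sqr_lin_le G s (- expR (- (2 * K * t))) (P t (Gamma G f f))
  (Gamma G (P t f) (P t f)).
rewrite sqrrN; under eq_bigr do rewrite mulNr addrC.
move=> /le_trans; apply.
have M30 : 0 <= \sum_(x <- s) m G x * P t (Gamma G f f) x ^+ 2.
  by apply: sumr_ge0 => x _; rewrite mulr_ge0 ?sqr_ge0// ltW// m_gt0.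
rewrite lerD// ?ler_wpM2l//.
by apply: ler_pM => //; rewrite ler_wpM2l.
Qed.

(* Cutting off by [eta k] keeps every sum finite, so that differentiating in
   time needs no exchange of limits. *)
Let phi (s : seq V) k t := \sum_(x <- s) m G x * eta k x ^+ 2 * pos_part (v t) x ^+ 2.

(** The positive part need not be differentiable, so [phi] is compared with a differentiable
    majorant touching it at time [t]. The right derivative of the majorant is estimated with the
    subsolution property and the cut-off inequality. *)
Lemma weighted_defect_step s k M (t : R) : uniq s -> CD_infty G K -> 0 <= t -> 0 <= M ->
  (forall x, eta k x != 0 -> x \in s /\ {subset nbr G x <= s}) ->
  \sum_(x <- s) m G x * v t x ^+ 2 <= M ->
  \forall h \near 0^'+, phi s k (t + h) <= phi s k t +
    h * ((4 * `|K| + 1) * phi s k t + (2 * M + 1) / k.+1%:R).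
Proof.
move=> us cd t0 M0 hs hM.
have pos_ge0 u x : 0 <= pos_part u x by rewrite /pos_part le_max lexx orbT.
(* The majorant: since the positive part at time [t] is at least [v t x], adding the increment of
   [v] gives a number at least [v t' x], whose square dominates that of the positive part. *)
pose r t' := \sum_(x <- s)
  m G x * eta k x ^+ 2 * ((pos_part (v t) x + (v t' x - v t x)) *
                         (pos_part (v t) x + (v t' x - v t x))).
pose l := \sum_(x <- s) m G x * eta k x ^+ 2 * (2 * pos_part (v t) x * dv t x).
have rt : r t = phi s k t.
  by apply: eq_bigr => x _; rewrite subrr addr0 -expr2.
have phi_le t' : phi s k t' <= r t'.
  apply: ler_sum => x _; apply: ler_wpM2l.
    by rewrite mulr_ge0 ?sqr_ge0// ltW// m_gt0.
  rewrite -expr2 -[leRHS]real_normK ?num_real// lerXn2r ?nnegrE//.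
  rewrite {1}/pos_part ge_max normr_ge0 andbT.
  apply: le_trans (ler_norm _); rewrite addrCA lerDl subr_ge0.
  by rewrite /pos_part le_max lexx.
have r' : right_deriv r t l.
  apply/right_deriv_sum => x; apply/right_derivZ.
  have v' : right_deriv (fun t' => v t' x - v t x) t (dv t x - 0).
    exact: (right_derivB (gradient_defect_right_deriv t0) (@right_deriv_cst R (v t x) t)).
  have b' := right_derivD (@right_deriv_cst R (pos_part (v t) x) t) v'.
  rewrite [X in right_deriv _ _ X](_ : _ =
    (0 + (dv t x - 0)) * (pos_part (v t) x + (v t x - v t x)) +
    (pos_part (v t) x + (v t x - v t x)) * (0 + (dv t x - 0))); last first.
    by rewrite subrr; ring.
  exact: (right_derivM b' b').
have phi0 : 0 <= phi s k t.
  apply: sumr_ge0 => x _; rewrite mulr_ge0 ?sqr_ge0// mulr_ge0 ?sqr_ge0//.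
  by rewrite ltW// m_gt0.
have l_le : l <= 4 * `|K| * phi s k t + 2 * M / k.+1%:R.
  apply: (@le_trans _ _ (2 * (\sum_(x <- s) eta k x ^+ 2 * pos_part (v t) x *
      (m G x * Delta G (v t) x)) - 4 * K * phi s k t)).
    rewrite mulr_sumr mulr_sumr -sumrB; apply: ler_sum => x _.
    have w0 : 0 <= 2 * m G x * eta k x ^+ 2 * pos_part (v t) x.
      rewrite mulr_ge0// mulr_ge0 ?sqr_ge0// mulr_ge0//.
      by rewrite ltW// m_gt0.
    have pv : pos_part (v t) x * v t x = pos_part (v t) x ^+ 2.
      by rewrite /pos_part; case: (leP (v t x) 0) => _; rewrite ?mul0r ?expr0n.
    have := ler_wpM2l w0 (gradient_defect_subsolution t x cd).
    rewrite -pv; move: (v t x) (dv t x) (Delta G (v t) x) => a b d.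
    by congr (_ <= _); ring.
  rewrite [leRHS]addrC; apply: lerD.
    rewrite -[leRHS]mulrA ler_wpM2l//.
    apply: le_trans (@pos_part_Delta_le _ _ G s (eta k) (v t) us hs) _.
    apply: (@le_trans _ _ ((\sum_(x <- s) m G x * v t x ^+ 2) / k.+1%:R)); last first.
      by rewrite ler_wpM2r// invr_ge0.
    rewrite mulr_suml; apply: ler_sum => x _; apply: ler_pM => //.
    - by rewrite mulr_ge0 ?sqr_ge0// ltW// m_gt0.
    - exact: Gamma_ge0.
    - rewrite ler_wpM2l ?(ltW (m_gt0 G x))//.
      rewrite /pos_part; case: (leP (v t x) 0) => _ //.
      by rewrite expr0n sqr_ge0.
  by rewrite -mulNr ler_wpM2r// -mulrN ler_wpM2l// -normrN ler_norm.
(* The additional [phi] and [1 / (k + 1)] make the inequality strict, so it passes from the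
   derivative to the difference quotients for small [h]; the [+ 1] also keeps the Gronwall constant
   positive when [K = 0]. *)
have l_lt : l < (4 * `|K| + 1) * phi s k t + (2 * M + 1) / k.+1%:R.
  apply: le_lt_trans l_le _.
  rewrite [ltRHS](_ : _ = 4 * `|K| * phi s k t + 2 * M / k.+1%:R +
    (phi s k t + k.+1%:R^-1)); last ring.
  by rewrite ltrDl ltr_wpDl// invr_gt0.
have := @cvgr_lt _ _ _ _ _ _ r' _ l_lt.
move=> hlt; near=> h.
have h0 : 0 < h by near: h; exact: nbhs_right_gt.
have : h^-1 * (r (t + h) - r t) <= (4 * `|K| + 1) * phi s k t + (2 * M + 1) / k.+1%:R.
  by apply/ltW; near: h; exact: hlt.
rewrite ler_pdivrMl// rt lerBlDl; exact: le_trans.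
Unshelve. all: by end_near. Qed.

Lemma weighted_defect_cont s k (t0 : R) : 0 <= t0 ->
  phi s k t @[t --> within [set t | 0 <= t] (nbhs t0)] --> phi s k t0.
Proof.
move=> t00; apply: cvg_big => [|x _]; first exact: add_continuous.
apply: cvgM; first exact: cvg_cst.
have c : pos_part (v t) x @[t --> within [set t | 0 <= t] (nbhs t0)]
    --> pos_part (v t0) x.
  rewrite /pos_part maxr_absE; under eq_fun do rewrite maxr_absE.
  have c0 := gradient_defect_cont (x := x) t00.
  apply: cvgM; last exact: cvg_cst.
  apply: cvgD; first by apply: cvgD => //; exact: cvg_cst.
  by apply: cvg_norm; apply: cvgB => //; exact: cvg_cst.
exact: cvgM.
Qed.

(** A single vertex is dominated by [phi], whose Gronwall bound is a constant independent of [k]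
    times [1 / (k + 1)]; the list [s] varies with [k], but [M] does not. *)
Lemma gradient_defect_le0 t x : nondegenerate_measure G -> CD_infty G K ->
  0 <= t -> v t x <= 0.
Proof.
move=> nd cd t0.
have [M M0 hM] := gradient_defect_bounded t nd.
pose C : R := 4 * `|K| + 1.
have C_gt0 : 0 < C by rewrite ltr_wpDl// mulr_ge0.
pose c := (2 * M + 1) / C * (expR (C * t) - 1).
have bound k : m G x * eta k x ^+ 2 * pos_part (v t) x ^+ 2 <= c * k.+1%:R^-1.
  have [s us hs] := C0_surround G (eta_C0 k).
  have phi_le : phi s k t <= c * k.+1%:R^-1.
    have := @right_gronwall R (phi s k) t C ((2 * M + 1) / k.+1%:R) C_gt0.
    move=> /(_ _ _ (weighted_defect_cont (s := s) (k := k)) _ t).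
    rewrite t0 lexx => gr.
    have -> : c * k.+1%:R^-1 = (2 * M + 1) / k.+1%:R / C * (expR (C * t) - 1).
      by rewrite /c; ring.
    apply: gr => //.
    - by rewrite divr_gt0// ltr_wpDl// mulr_ge0.
    - rewrite /phi big1// => y _.
      by rewrite /pos_part gradient_defect0 maxxx expr0n mulr0.
    - move=> t' t't; have /andP[t'0 _] := t't.
      by apply: weighted_defect_step => //; exact: hM.
  have term0 y : 0 <= m G y * eta k y ^+ 2 * pos_part (v t) y ^+ 2.
    by rewrite mulr_ge0 ?sqr_ge0// mulr_ge0 ?sqr_ge0// ltW// m_gt0.
  apply: le_trans phi_le; have [xs|xs] := boolP (x \in s).
    by rewrite /phi (bigD1_seq x)//= lerDl sumr_ge0.
  have -> : eta k x = 0 by apply: contraNeq xs => /hs[].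
  by rewrite expr0n mulr0 mul0r; apply: sumr_ge0.
have lim1 : m G x * eta k x ^+ 2 * pos_part (v t) x ^+ 2 @[k --> \oo]
    --> m G x * 1 ^+ 2 * pos_part (v t) x ^+ 2.
  apply: cvgM; last exact: cvg_cst.
  by apply: cvgM; [exact: cvg_cst|apply: cvgM; exact: eta_cvg].
have lim2 : c * k.+1%:R^-1 @[k --> \oo] --> c * 0.
  by apply: cvgM; [exact: cvg_cst|exact: cvg_harmonic].
have : m G x * 1 ^+ 2 * pos_part (v t) x ^+ 2 <= c * 0.
  by apply: (ler_cvg_to lim1 lim2); apply: nearW.
rewrite expr1n mulr1 mulr0 pmulr_rle0 ?m_gt0// => pos2.
have /eqP : pos_part (v t) x ^+ 2 == 0 by rewrite eq_le pos2 sqr_ge0.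
move/eqP; rewrite sqrf_eq0 => /eqP <-.
by rewrite /pos_part le_max lexx.
Qed.

End Bound.

(** At time 0 the right derivative of the defect equals [2 * (K * Gamma f - Gamma2 f)]. *)
Lemma curvature_of_gradient_defect x : (forall t, 0 <= t -> v t x <= 0) ->
  K * Gamma G f f x <= Gamma2 G f x.
Proof.
move=> v_le0.
have : dv 0 x <= 0.
  apply: (right_deriv_le0 (gradient_defect_right_deriv (x := x) (lexx 0))) => s s0.
  by rewrite gradient_defect0; exact: v_le0.
rewrite /dv (heat0 heatP f0) (heat0 heatP (C0_Gamma G f0)).
by rewrite mulr0 oppr0 expR0 mul1r /Gamma2; lra.
Qed.

End Flow.

(** * Locality of the curvature condition *)

Lemma eq_Delta f g x : f x = g x -> {in nbr G x, f =1 g} ->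
  Delta G f x = Delta G g x.
Proof.
move=> fgx fg; rewrite !DeltaE fgx; congr (_ * _).
by apply: eq_big_seq => y /fg ->.
Qed.

(** [Gamma2] at [x] involves [Delta f] and [Gamma f] at [x] and its neighbours, hence only [f] on
    the ball of radius two. *)
Lemma Gamma2_local f g x :
  {in hull G (hull G [:: x]), f =1 g} -> Gamma2 G f x = Gamma2 G g x.
Proof.
move=> fg; pose s := hull G [:: x].
have sx : x \in s by apply: sub_hull; rewrite inE.
have sn y : y \in nbr G x -> y \in s by apply: nbr_hull; rewrite inE.
have fgs y : y \in s -> f y = g y by move=> ys; apply: fg; exact: sub_hull.
have fgn y : y \in s -> {in nbr G y, f =1 g}.
  by move=> ys z zy; apply: fg; exact: (nbr_hull ys).
have DD y : y \in s -> Delta G f y = Delta G g y.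
  by move=> ys; apply: eq_Delta; [exact: fgs|exact: fgn].
have GG y : y \in s -> Gamma G f f y = Gamma G g g y.
  move=> ys; rewrite !GammaE (fgs y ys); congr (_ * _).
  by apply: eq_big_seq => z /(fgn y ys) ->.
rewrite /Gamma2; congr (_ * _ - _).
  by apply: eq_Delta => [|y /sn]; exact: GG.
rewrite !GammaE (fgs x sx) (DD x sx); congr (_ * _).
by apply: eq_big_seq => y /sn ys; rewrite (fgs y ys) (DD y ys).
Qed.

(** An arbitrary [f] is truncated to the ball of radius two around [x], which changes neither side
    at [x]. *)
Lemma CD_infty_C0 (K : R) :
  (forall f, C0 f -> forall x, K * Gamma G f f x <= Gamma2 G f x) ->
  CD_infty G K.
Proof.
move=> h f x; pose s := hull G (hull G [:: x]).
pose g y := if y \in s then f y else 0.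
have fg : {in s, f =1 g} by move=> y ys; rewrite /g ys.
have g0 : C0 g.
  by apply: (@C0_seq _ _ s) => y; rewrite /g; case: ifP => //; rewrite eqxx.
rewrite (Gamma2_local fg) [Gamma G f f x](_ : _ = Gamma G g g x) ?h//.
have sx : x \in hull G [:: x] by apply: sub_hull; rewrite inE.
have sx' : x \in s by exact: sub_hull.
rewrite !GammaE (fg x sx'); congr (_ * _).
by apply: eq_big_seq => y /(nbr_hull sx) ys; rewrite (fg y ys).
Qed.

End GradientEstimate.

Theorem theorem1p1 (R : realType) (V : choiceType) (G : weighted_graph R V)
    (K : R) (P : R -> (V -> R) -> V -> R) :
  complete_graph G ->
  nondegenerate_measure G ->
  is_heat_semigroup G P ->
  CD_infty G K <->
  (forall f, C0 f -> forall t : R, 0 <= t -> forall x,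
     Gamma G (P t f) (P t f) x <= expR (- (2 * K * t)) * P t (Gamma G f f) x).
Proof.
move=> [eta [eta_C0 eta_mono eta_cvg eta_Gamma]] nd heatP; split.
  move=> cd f f0 t t0 x; rewrite -subr_le0.
  exact: (gradient_defect_le0 heatP f0 eta_C0 eta_mono eta_cvg eta_Gamma).
move=> grad; apply: CD_infty_C0 => f f0 x.
apply: (curvature_of_gradient_defect heatP f0) => t t0.
by rewrite subr_le0 grad.
Qed.
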